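(* Let $f:\mathcal{X}\to\mathbb{R}$ and $g:\mathcal{Y}\to\mathbb{R}$ be twice continuously differentiable and strongly convex with parameters $\mu_f>0$ and $\mu_g>0$, respectively, let $A:\mathcal{X}\to\mathcal{Y}$ be a bounded linear operator, put $\mathcal{L}(x,y)=f(x)+\langle Ax,y\rangle-g(y)$, and let $(x^*,y^* )\in\mathcal{X}\times\mathcal{Y}$ be a saddle point of $\mathcal{L}$. Let $t_0>0$, $\alpha\ge3$, $\beta_f,\beta_g,\gamma>0$, $r\ge\max(\beta_f,\beta_g)$ and $\theta=\frac{1}{\alpha-1}$. Let $(x,y):[t_0,\infty)\to\mathcal{X}\times\mathcal{Y}$ be a solution of the system $$\begin{cases}\ddot{x}+\frac{\alpha}{t}\dot{x}+\beta_f\nabla_{xx}\mathcal{L}(x,y)\dot{x}+\left(\gamma+\frac{r}{t}\right)\nabla_x\mathcal{L}(x,y+\theta t\dot{y})=0,\\ \ddot{y}+\frac{\alpha}{t}\dot{y}-\beta_g\nabla_{yy}\mathcal{L}(x,y)\dot{y}-\left(\gamma+\frac{r}{t}\right)\nabla_y\mathcal{L}(x+\theta t\dot{x},y)=0.\end{cases}$$ Let $$T=\max\left(t_0,\ \tfrac{\alpha-3}{\min(\mu_f\beta_f,\mu_g\beta_g)},\ \tfrac{(\alpha-3)\beta_f}{\gamma}+\sqrt{\tfrac{2(\alpha-1)(\alpha-3)}{\gamma\mu_f}},\ \tfrac{(\alpha-3)\beta_g}{\gamma}+\sqrt{\tfrac{2(\alpha-1)(\alpha-3)}{\gamma\mu_g}}\right).$$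 Then for $t\ge T$: (i) $\sqrt{\|x(t)-x^*\|^2+\|y(t)-y^*\|^2}=\mathcal{O}\left(\frac{1}{t^{(\alpha-2)/2}}\right)$; (ii) $\sqrt{\|\dot{x}(t)\|^2+\|\dot{y}(t)\|^2}=\mathcal{O}\left(\frac{1}{t^{(\alpha-1)/2}}\right)$; (iii) $\mathcal{L}(x(t),y^* )-\mathcal{L}(x^*,y(t))=\mathcal{O}\left(\frac{1}{t^{\alpha-1}}\right)$. Here $u(t)=\mathcal{O}(v(t))$ means that there is a constant $C$ independent of $t$ with $|u(t)|\le C\,v(t)$ for every $t\ge T$.
   Context: $\mathcal{X}$ and $\mathcal{Y}$ are real Hilbert spaces; $A^*:\mathcal{Y}\to\mathcal{X}$ is the adjoint of $A$. A saddle point $(x^*,y^* )$ of $\mathcal{L}$ satisfies $\mathcal{L}(x^*,y)\le\mathcal{L}(x^*,y^* )\le\mathcal{L}(x,y^* )$ for all $(x,y)\in\mathcal{X}\times\mathcal{Y}$; equivalently $\nabla f(x^* )+A^*y^*=0$ and $\nabla g(y^* )-Ax^*=0$. A function $\phi$ is strongly convex with parameter $\mu>0$ if $\phi-\frac{\mu}{2}\|\cdot\|^2$ is convex. The functions $x,y$ are evaluated at $t$ in the system, and a solution is a twice differentiable function satisfying the system on $[t_0,\infty)$. Explicitly, $\nabla_x\mathcal{L}(x,y)=\nabla f(x)+A^*y$, $\nabla_y\mathcal{L}(x,y)=Ax-\nabla g(y)$, $\nabla_{xx}\mathcal{L}(x,y)=\nabla^2 f(x)$, $\nabla_{yy}\mathcal{L}(x,y)=-\nabla^2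 g(y)$. *)

(* Defs.v *)
From HB Require Import structures.
From mathcomp Require Import all_boot all_order all_algebra.
From mathcomp Require Import all_classical all_reals all_analysis.
From mathcomp Require Import ring lra.

Set Implicit Arguments.
Unset Strict Implicit.
Unset Printing Implicit Defensive.

Import Order.TTheory GRing.Theory Num.Theory.
Import numFieldNormedType.Exports.

Local Open Scope classical_set_scope.
Local Open Scope ring_scope.

(* A real Hilbert space: a complete normed space whose norm comes from an inner
   product. Linearity on the right follows by symmetry, definiteness from the
   norm. *)
HB.mixin Record CompleteNormedModule_isHilbert (R : realType) V
    of CompleteNormedModule R V := {
  inner : V -> V -> R ;
  inner_sym : forall u v, inner u v = inner v u ;
  inner_linearl : forall (a : R) u v w,
    inner (a *: u + v) w = a * inner u w + inner v w ;
  inner_norm : forall u, inner u u = `|u| ^+ 2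
}.

#[short(type="hilbertType")]
HB.structure Definition Hilbert (R : realType) :=
  {V of CompleteNormedModule R V & CompleteNormedModule_isHilbert R V}.

Section Riesz.
Context {R : realType} {X : hilbertType R}.
Implicit Types u v w h : X.

Lemma innerDl u v w : inner (u + v) w = inner u w + inner v w.
Proof. by have := inner_linearl 1 u v w; rewrite scale1r mul1r. Qed.

Lemma inner0l w : inner (0 : X) w = 0.
Proof. by have := innerDl 0 0 w; rewrite addr0 => h; lra. Qed.

Lemma innerZl a u w : inner (a *: u) w = a * inner u w.
Proof. by have := inner_linearl a u 0 w; rewrite addr0 inner0l addr0. Qed.

Lemma innerDr u v w : inner w (u + v) = inner w u + inner w v.
Proof. by rewrite !(inner_sym w) innerDl. Qed.

Lemma innerZr a u w : inner w (a *: u) = a * inner w u.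
Proof. by rewrite !(inner_sym w) innerZl. Qed.

Lemma normDZ_sqr a u v :
  `|u + a *: v| ^+ 2 = `|u| ^+ 2 + 2 * a * inner u v + a ^+ 2 * `|v| ^+ 2.
Proof.
rewrite -!inner_norm innerDl !innerDr !innerZl !innerZr (inner_sym v u); ring.
Qed.

Lemma riesz (l : {linear X -> R}) : continuous l ->
  exists v : X, forall h, l h = inner v h.
Proof.
move=> cl.
have [M M0 lM] : exists2 M, 0 <= M & forall u, `|l u| <= M * `|u|.
  have /linear_boundedP : bounded_near l (nbhs (0 : X)).
    exact/linear_bounded_continuous.
  move=> /pinfty_ex_gt0[M M0 H]; exists M => //; exact: ltW.
pose J u := `|u| ^+ 2 / 2 - l u.
have Jlb u : - (M ^+ 2 / 2) <= J u.
  have := lM u; rewrite ler_norml => /andP[_].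
  have := sqr_ge0 (`|u| - M); rewrite /J; nra.
pose S := range J.
have hS : has_inf S.
  split; first by exists (J 0), 0.
  by exists (- (M ^+ 2 / 2)) => _ [u _ <-].
pose m := inf S.
have Jm u : m <= J u by apply: ge_inf; [exact: hS.2|exists u].
have par u v : `|u - v| ^+ 2 <= 4 * ((J u - m) + (J v - m)).
  have := Jm (2^-1 *: (u + v)).
  rewrite /J normrZ exprMn linearZ linearD /= -[_ *: _]/(_ * _).
  rewrite (_ : `|2^-1 : R| ^+ 2 = 4^-1); last by rewrite ger0_norm ?invr_ge0//; lra.
  have := normDZ_sqr 1 u v; have := normDZ_sqr (-1) u v.
  rewrite scale1r scaleN1r; lra.
pose F := filter_from [set e : R | 0 < e] (fun e => [set u | J u < m + e]).
have FF : ProperFilter F.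
  apply: filter_from_proper.
    apply: filter_from_filter; first by exists 1 => /=.
    move=> i j /= i0 j0; exists (Num.min i j); first by rewrite /= lt_min i0.
    move=> u /= Ju; split; apply: (lt_le_trans Ju); rewrite lerD2l ge_min lexx ?orbT//.
  move=> e /= e0; have [_ [u _ <-] ?] := inf_adherent e0 hS; by exists u.
have : cauchy F.
  apply/cauchy_ballP => e e0.
  pose d := e ^+ 2 / 16.
  have d0 : 0 < d by rewrite /d divr_gt0// exprn_gt0.
  exists ([set u | J u < m + d], [set u | J u < m + d]).
    by split; exists d.
  move=> [u v] [/= Ju Jv]; rewrite -ball_normE /=.
  rewrite -(@ltr_pXn2r _ 2)// ?nnegrE// ?(ltW e0)//.
  by apply: le_lt_trans (par u v) _; move: Ju Jv; rewrite /d; nra.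
move=> /cauchy_cvg; set v := lim F => Fv.
have cJ : continuous J.
  move=> u; rewrite /J; apply: cvgB; last exact: cl.
  apply: cvgMl; rewrite /=.
  under eq_fun do rewrite expr2.
  by rewrite expr2; apply: cvgM; apply: cvg_norm; apply: cvg_id.
have Jv : J v <= m.
  apply/ler_addgt0Pr => e e0.
  have JF : J @ F --> J v by apply: continuous_cvg => //; exact: cJ.
  apply: (cvgr_to_le JF).
  by exists e => //= u /= /ltW.
exists v => h.
apply/eqP; rewrite eq_sym -subr_eq0; apply/eqP; set c := _ - _.
have key s : 0 <= s * c + s ^+ 2 / 2 * `|h| ^+ 2.
  have := le_trans Jv (Jm (v + s *: h)).
  rewrite /J normDZ_sqr linearD linearZ /= -[_ *: l h]/(_ * _) /c; lra.
have N0 : 0 < 1 + `|h| ^+ 2 by rewrite ltr_wpDr.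
have := key (- c / (1 + `|h| ^+ 2)).
set N := 1 + _ in N0 *.
have hN : `|h| ^+ 2 = N - 1 by rewrite /N; lra.
rewrite hN => H.
have E : - c / N * c + (- c / N) ^+ 2 / 2 * (N - 1) = - (c ^+ 2 * (N + 1)) / (2 * N ^+ 2).
  by field; rewrite gt_eqF.
move: H; rewrite E mulNr oppr_ge0 pmulr_lle0 ?invr_gt0 ?mulr_gt0 ?exprn_gt0//.
rewrite pmulr_lle0; last by lra.
by move=> c2; apply/eqP; rewrite -sqrf_eq0 eq_le c2 sqr_ge0.
Qed.

End Riesz.

Section Gradient.
Context {R : realType} {X : hilbertType R}.

(* The Riesz representative of the Frechet differential. *)
Definition grad (f : X -> R) (x : X) : X :=
  get [set v : X | forall h : X, 'd f x h = inner v h].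

Lemma gradP (f : X -> R) (x h : X) :
  differentiable f x -> 'd f x h = inner (grad f x) h.
Proof.
move=> df.
have [v hv] := riesz (diff_continuous df).
by rewrite /grad; case: xgetP => [_ -> //|/(_ v) []].
Qed.

(* The Hessian as an operator on X. *)
Definition hess (f : X -> R) (x : X) : X -> X := 'd (grad f) x.

(* The last clause is continuity of the Hessian in the operator norm. *)
Definition twice_continuously_differentiable (f : X -> R) : Prop :=
  [/\ forall x, differentiable f x,
      forall x, differentiable (grad f) x &
      forall (x : X) (e : R), 0 < e ->
        \forall z \near x, forall h : X,
          `|hess f z h - hess f x h| <= e * `|h|].

Definition strongly_convex (mu : R) (f : X -> R) : Prop :=
  convex_function [set: X] (fun x => f x - mu / 2 * `|x| ^+ 2).

End Gradient.

Section Saddle.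
Context {R : realType} {X Y : hilbertType R}.

Definition bounded_operator (A : X -> Y) : Prop :=
  exists M : R, forall x, `|A x| <= M * `|x|.

Definition lagrangian (f : X -> R) (g : Y -> R) (A : X -> Y) (x : X) (y : Y)
    : R :=
  f x + inner (A x) y - g y.

Definition saddle_point (L : X -> Y -> R) (xs : X) (ys : Y) : Prop :=
  forall x y, L xs y <= L xs ys /\ L xs ys <= L x ys.

Definition grad_x (L : X -> Y -> R) (x : X) (y : Y) : X := grad (L ^~ y) x.
Definition grad_y (L : X -> Y -> R) (x : X) (y : Y) : Y := grad (L x) y.
Definition hess_xx (L : X -> Y -> R) (x : X) (y : Y) : X -> X := hess (L ^~ y) x.
Definition hess_yy (L : X -> Y -> R) (x : X) (y : Y) : Y -> Y := hess (L x) y.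

End Saddle.

Section DerivativeWithin.
Context {R : realType} {V : normedModType R}.

(* Derivatives relative to a domain D: one-sided at the endpoints of an
   interval, and independent of the values of u outside D at points of D. *)
Definition derivable_on (D : set R) (u : R -> V) (t : R) : Prop :=
  cvg ((s - t)^-1 *: (u s - u t) @[s --> within D t^']).

Definition derive_on (D : set R) (u : R -> V) (t : R) : V :=
  lim ((s - t)^-1 *: (u s - u t) @[s --> within D t^']).

Definition twice_derivable_on (D : set R) (u : R -> V) : Prop :=
  (forall t, D t -> derivable_on D u t) /\
  (forall t, D t -> derivable_on D (derive_on D u) t).

End DerivativeWithin.

Definition bigO_from {R : realType} (T : R) (u v : R -> R) : Prop :=
  exists C : R, forall t, T <= t -> `|u t| <= C * v t.

(* Main.v *)
(* With w = (alpha - 1)(x - xs) + t x', the vector x + theta t x' - xs is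
   w / (alpha - 1), so the bilinear coupling terms disappear when the two
   equations are tested against w and its analogue for y. For phi = L(., ys),
   Phi = phi(x) - phi(xs) and D = <grad phi(x), x - xs> - Phi, the energy
     |w|^2 / 2 + t (gamma t + r) Phi + (alpha - 1) beta t D
   has an explicit derivative because D' = <hess phi(x) x', x - xs>; the same
   holds for psi = - L(xs, .). Strong convexity gives D >= mu/2 |x - xs|^2 and
   <hess phi(x) x', x'> >= mu |x'|^2, and for t >= T these absorb the term
   (alpha - 3) |w|^2 / 2 in the derivative of t^(alpha - 3) times the total
   energy, which is therefore nonincreasing. *)
From HB Require Import structures.
Require Import Defs.
From mathcomp Require Import all_boot all_order all_algebra.
From mathcomp Require Import all_classical all_reals all_analysis.
From mathcomp Require Import ring lra.

Set Implicit Arguments.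
Unset Strict Implicit.
Unset Printing Implicit Defensive.

Import Order.TTheory GRing.Theory Num.Theory.
Import numFieldNormedType.Exports.

Local Open Scope classical_set_scope.
Local Open Scope ring_scope.

(** * Inner product calculus and continuity *)

Section InnerProduct.
Context {R : realType} {X : hilbertType R}.
Implicit Types u v w : X.

Lemma innerNl u w : inner (- u) w = - inner u w.
Proof. by rewrite -scaleN1r innerZl mulN1r. Qed.

Lemma innerNr u w : inner w (- u) = - inner w u.
Proof. by rewrite !(inner_sym w) innerNl. Qed.

Lemma innerBl u v w : inner (u - v) w = inner u w - inner v w.
Proof. by rewrite innerDl innerNl. Qed.

Lemma innerBr u v w : inner w (u - v) = inner w u - inner w v.
Proof. by rewrite innerDr innerNr. Qed.

Lemma inner0r w : inner w (0 : X) = 0.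
Proof. by rewrite inner_sym inner0l. Qed.

Lemma inner_injl u v : (forall h, inner u h = inner v h) -> u = v.
Proof.
move=> uv; apply/eqP; rewrite -subr_eq0 -normr_eq0 -sqrf_eq0 -inner_norm.
by rewrite innerBl uv subrr.
Qed.

Lemma inner_polarization u v :
  inner u v = 4^-1 * (`|u + v| ^+ 2 - `|u - v| ^+ 2).
Proof.
by rewrite -!inner_norm !innerDl !innerDr !innerNl !innerNr (inner_sym v u); field.
Qed.

(** Polarization reduces joint continuity of the inner product to continuity of the norm. *)
Lemma cvg_inner T (F : set_system T) (FF : Filter F) (a b : T -> X) u v :
  a @ F --> u -> b @ F --> v -> inner (a s) (b s) @[s --> F] --> inner u v.
Proof.
move=> au bv; rewrite inner_polarization.
under eq_fun do rewrite inner_polarization !expr2.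
rewrite !expr2; apply: cvgM; first exact: cvg_cst.
by apply: cvgB; apply: cvgM; apply: cvg_norm; [apply: cvgD|apply: cvgD|apply: cvgB|apply: cvgB].
Qed.

Lemma linear_inner u : linear (inner u : X -> R).
Proof. by move=> a v w; rewrite innerDr innerZr. Qed.

Lemma continuous_inner u : continuous (inner u : X -> R).
Proof. by move=> v; apply: cvg_inner; [exact: cvg_cst|exact: cvg_id]. Qed.

End InnerProduct.

(** * Differentiation rules relative to a domain *)

Section DeriveWithin.
Context {R : realType} (D : set R).

#[local] Instance within_dnbhs_filter (t : R) : Filter (within D t^').
Proof. exact: within_filter. Qed.

Lemma near_eq_cvg_to {T : Type} {U : topologicalType} (F : set_system T)
    {FF : Filter F} (f g : T -> U) (l : U) :
  (\forall s \near F, f s = g s) -> f @ F --> l -> g @ F --> l.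
Proof. by move=> fg; apply: cvg_trans; exact: near_eq_cvg. Qed.

(** Relational form of the derivative, so that rules compose without computing limits;
    [derivable_on D u t] unfolds to this relation at [derive_on D u t]. *)
Definition is_derive_on {V : normedModType R} (u : R -> V) (t : R) (l : V) :=
  (s - t)^-1 *: (u s - u t) @[s --> within D t^'] --> l.

Lemma within_dnbhs_neq t : \forall s \near within D t^', s - t != 0.
Proof.
apply: (cvg_within (F := t^')).
by rewrite /dnbhs; apply: filterS (withinT _ _) => s; rewrite subr_eq0.
Qed.

Lemma is_derive_on_eq {V : normedModType R} (u v : R -> V) t l m :
  u =1 v -> l = m -> is_derive_on u t l -> is_derive_on v t m.
Proof. by move=> /funext -> ->. Qed.

Lemma is_derive_on_cst {V : normedModType R} (c : V) t :
  is_derive_on (fun=> c) t 0.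
Proof.
rewrite /is_derive_on; under eq_fun do rewrite subrr scaler0.
exact: cvg_cst.
Qed.

Lemma is_derive_on_id t : is_derive_on (fun s : R => s) t 1.
Proof.
apply: (@cvg_trans _ ((fun=> 1) @ within D t^')); last exact: cvg_cst.
apply: near_eq_cvg; near=> s.
by rewrite -[_ *: _]/(_ * _) mulVf //; near: s; exact: within_dnbhs_neq.
Unshelve. all: by end_near. Qed.

Lemma is_derive_onD {V : normedModType R} (u v : R -> V) t l m :
  is_derive_on u t l -> is_derive_on v t m ->
  is_derive_on (fun s => u s + v s) t (l + m).
Proof.
move=> ul vm; rewrite /is_derive_on.
under eq_fun do rewrite opprD addrACA scalerDr.
exact: cvgD.
Qed.

Lemma is_derive_on_continuous {V : normedModType R} (u : R -> V) t l :
  is_derive_on u t l -> u s @[s --> within D t^'] --> u t.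
Proof.
move=> ul.
have st : (s - t) @[s --> within D t^'] --> (0 : R).
  rewrite -(subrr t); apply: cvgB; last exact: cvg_cst.
  exact: cvg_trans (@cvg_within _ _ _ D) (@cvg_within _ _ _ _).
(* The increment is [s - t], which tends to 0, times a convergent quotient. *)
have H : (s - t) *: ((s - t)^-1 *: (u s - u t)) + u t @[s --> within D t^']
    --> 0 *: l + u t.
  by apply: cvgD; [exact: cvgZ|exact: cvg_cst].
rewrite scale0r add0r in H.
 apply: (near_eq_cvg_to _ H); near=> s.
rewrite /= scalerA divff ?scale1r ?subrK//; near: s; exact: within_dnbhs_neq.
Unshelve. all: by end_near. Qed.

Lemma is_derive_onZ {V : normedModType R} (a : R -> R) (u : R -> V) t k l :
  is_derive_on a t k -> is_derive_on u t l ->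
  is_derive_on (fun s => a s *: u s) t (k *: u t + a t *: l).
Proof.
move=> ak ul; rewrite /is_derive_on.
have ut := is_derive_on_continuous ul.
have H : (s - t)^-1 *: (a s - a t) *: u s + a t *: ((s - t)^-1 *: (u s - u t))
    @[s --> within D t^'] --> k *: u t + a t *: l.
  by apply: cvgD; [exact: cvgZ|apply: cvgZ => //; exact: cvg_cst].
apply: (near_eq_cvg_to _ H); near=> s => /=.
rewrite scalerA [a t * _]mulrC -!scalerA -scalerDr; congr (_ *: _).
by rewrite scalerBl scalerBr addrA subrK.
Unshelve. all: by end_near. Qed.

Lemma is_derive_onM (a b : R -> R) t k l :
  is_derive_on a t k -> is_derive_on b t l ->
  is_derive_on (fun s => a s * b s) t (k * b t + a t * l).
Proof. exact: is_derive_onZ. Qed.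

Lemma is_derive_on_inner {X : hilbertType R} (u v : R -> X) t l m :
  is_derive_on u t l -> is_derive_on v t m ->
  is_derive_on (fun s => inner (u s) (v s)) t (inner l (v t) + inner (u t) m).
Proof.
move=> ul vm.
have vt := is_derive_on_continuous vm.
have H : inner ((s - t)^-1 *: (u s - u t)) (v s)
    + inner (u t) ((s - t)^-1 *: (v s - v t))
    @[s --> within D t^'] --> inner l (v t) + inner (u t) m.
  by apply: cvgD; [exact: cvg_inner|apply: cvg_inner => //; exact: cvg_cst].
apply: (near_eq_cvg_to _ H); near=> s => /=.
rewrite innerZl innerZr -mulrDr; congr (_ * _).
by rewrite innerBl innerBr addrA subrK.
Unshelve. all: by end_near. Qed.

(** Chain rule: the differential is continuous, hence passes to the limit on the quotients of [u];
    the remainder is small relative to the increment of [u], whose quotients stay bounded. *)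
Lemma is_derive_on_comp {V W : normedModType R} (phi : V -> W) (u : R -> V) t l :
  differentiable phi (u t) -> is_derive_on u t l ->
  is_derive_on (fun s => phi (u s)) t ('d phi (u t) l).
Proof.
move=> dphi ul.
have dl : 'd phi (u t) ((s - t)^-1 *: (u s - u t)) @[s --> within D t^']
    --> 'd phi (u t) l.
  by apply: continuous_cvg => //; exact: diff_continuous.
have bl : \forall s \near within D t^', `|(s - t)^-1 *: (u s - u t)| <= `|l| + 1.
  by apply: cvgr_norm_le; [exact: ul|rewrite ltrDl].
apply/cvgrPdist_le => e e0.
have M0 : 0 < `|l| + 1 by rewrite ltr_wpDl.
have e'0 : 0 < e / 2 / (`|l| + 1) by rewrite !divr_gt0.
have e20 : 0 < e / 2 by rewrite divr_gt0.
(* The quotients of [u] are eventually bounded by [|l| + 1], so this tolerance makes the remainder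
   contribute at most [e / 2]. *)
have rem : \forall z \near u t,
    `|phi z - phi (u t) - 'd phi (u t) (z - u t)| <= e / 2 / (`|l| + 1) * `|z - u t|.
  have /diff_locally/eqaddoP/(_ _ e'0) H := dphi.
  apply/nbhs0P; near=> h.
  have : `|(phi \o shift (u t) - (cst (phi (u t)) + 'd phi (u t))) h| <=
    e / 2 / (`|l| + 1) * `|h| by near: h.
  by rewrite /= !fctE [u t + h]addrC addrK opprD addrA.
have remu := is_derive_on_continuous ul rem.
near=> s.
have -> : 'd phi (u t) l - (s - t)^-1 *: (phi (u s) - phi (u t)) =
   ('d phi (u t) l - 'd phi (u t) ((s - t)^-1 *: (u s - u t)))
   - (s - t)^-1 *: (phi (u s) - phi (u t) - 'd phi (u t) (u s - u t)).
  rewrite [in RHS](scalerBr _ (phi (u s) - _)) ['d phi (u t) (_ *: _)]linearZ /=.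
  by rewrite [in RHS]opprB addrA subrK.
apply: le_trans (ler_normB _ _) _; rewrite [e]splitr; apply: lerD.
  by near: s; apply: cvgr_dist_le; [exact: dl|].
rewrite normrZ.
have Hs : `|phi (u s) - phi (u t) - 'd phi (u t) (u s - u t)| <= e / 2 / (`|l| + 1) * `|u s - u t|.
  by near: s; exact: remu.
have Hb : `|(s - t)^-1 *: (u s - u t)| <= `|l| + 1 by near: s.
rewrite normrZ in Hb.
apply: le_trans (ler_wpM2l (normr_ge0 _) Hs) _.
rewrite mulrCA; apply: le_trans (ler_wpM2l (ltW e'0) Hb) _.
by rewrite divfK// gt_eqF.
Unshelve. all: by end_near. Qed.

Lemma is_derive_on_is_derive (a : R -> R) t k :
  @is_derive R R R t 1 a k -> is_derive_on a t k.
Proof.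
move=> [/derivable1_diffP da <-].
have := is_derive_on_comp (phi := a) (u := id) da (is_derive_on_id t).
by rewrite deriveE.
Qed.

End DeriveWithin.

(** * Monotonicity from the sign of a relative derivative *)

Section Monotonicity.
Context {R : realType}.

Lemma is_derive_on_nonincreasing (D : set R) (E dE : R -> R) (T : R) :
  `[T, +oo[ `<=` D ->
  (forall t, T <= t -> is_derive_on D E t (dE t)) ->
  (forall t, T <= t -> dE t <= 0) ->
  forall t, T <= t -> E t <= E T.
Proof.
move=> TD dEE dE0 t Tt.
(* Beyond [T] a whole neighbourhood lies in [D], so the relative derivative is the ordinary
   two-sided one. *)
have ED s : T < s -> @is_derive R R R s 1 E (dE s).
  move=> Ts.
  have H : (fun h : R => h^-1 *: ((E \o shift s) (h *: 1) - E s)) @ 0^' --> dE s.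
    have /cvgrPdist_lt K := dEE s (ltW Ts).
    apply/cvgrPdist_lt => e e0.
    have /nbhs0P K' : \forall z \near s, z != s -> D z ->
      `|dE s - (z - s)^-1 *: (E z - E s)| < e := K e e0.
    suff : \forall h \near (0 : R), h != 0 ->
      `|dE s - h^-1 *: ((E \o shift s) (h *: 1) - E s)| < e by [].
    have Dn : \forall h \near (0:R), D (s + h).
      have : \forall z \near s, D z.
        by near=> z; apply: TD; rewrite /= in_itv/= andbT ltW//; near: z; exact: lt_nbhsr.
      by move/nbhs0P.
    near=> h => h0.
    have K2 : s + h != s -> D (s + h) ->
      `|dE s - (s + h - s)^-1 *: (E (s + h) - E s)| < e by near: h.
    rewrite /= [h%:A]mulr1 [h + s]addrC.
    have -> : h^-1 = (s + h - s)^-1 by rewrite addrC addKr.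
    apply: K2; last by near: h.
    by rewrite -subr_eq0 addrC addKr.
  by split; [apply/cvg_ex; exists (dE s)|exact: (cvg_lim _ H)].
apply: (@ler0_derive1_nincry _ E T) => //.
- by move=> s; rewrite in_itv/= andbT => /ED [].
- move=> s; rewrite in_itv/= andbT => Ts; rewrite derive1E.
  by have [_ ->] := ED _ Ts; apply: dE0; exact: ltW.
(* At [T] itself only continuity from the right is required, and it follows from the relative
   derivative. *)
- apply/continuous_within_itvcyP; split.
    move=> s; rewrite in_itv/= andbT => /ED [/derivable1_diffP Es _].
    exact: differentiable_continuous.
  move=> U /(is_derive_on_continuous (dEE _ (lexx T))) H.
  have {}H : \forall s \near T, s != T -> D s -> U (E s) := H.
  suff : \forall s \near T, T < s -> U (E s) by [].
  near=> s => Ts.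
  have : s != T -> D s -> U (E s) by near: s.
  by apply; [rewrite gt_eqF|apply: TD; rewrite /= in_itv/= andbT ltW].
Unshelve. all: by end_near. Qed.

End Monotonicity.

(** * Gradients, and first- and second-order consequences of strong convexity *)

Section Gradient.
Context {R : realType} {X : hilbertType R}.
Implicit Types (f phi : X -> R) (p q h : X).

HB.instance Definition _ (c : X) :=
  GRing.isLinear.Build R X R *:%R (inner c) (linear_inner c).

(* With [e] equal to 1 or -1 this covers both [L ^~ y] and [L x]. *)
Lemma grad_affine (e k : R) (c : X) f p : differentiable f p ->
  differentiable (fun z => e * f z + inner c z + k) p /\
  grad (fun z => e * f z + inner c z + k) p = e *: grad f p + c.
Proof.
move=> df.
have dc : is_diff p (inner c) (inner c).
  by apply: DiffDef; [exact/linear_differentiable/continuous_inner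
                     |exact/diff_lin/continuous_inner].
have dF : is_diff p ((e *: f : X -> R) + inner c + cst k) ((e *: ('d f p : X -> R)) + inner c + 0).
  apply: is_diffD; apply: is_diffD; apply: is_diffZ.
  exact: DiffDef.
have FE : (fun z => e * f z + inner c z + k) = (e *: f : X -> R) + inner c + cst k.
  by [].
rewrite FE; split; first exact: ex_diff.
apply: inner_injl => h.
rewrite -gradP; last exact: ex_diff.
by rewrite diff_val !fctE innerDl innerZl -gradP// addr0.
Qed.

Lemma is_derive_on_line (D : set R) p h (t : R) :
  is_derive_on D (fun s : R => p + s *: h) t h.
Proof.
apply: is_derive_on_eq (is_derive_onD (is_derive_on_cst _ p _)
   (is_derive_onZ (is_derive_on_id _ t) (is_derive_on_cst _ h _))) => //=.
by rewrite scaler0 add0r addr0 scale1r.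
Qed.

(** If [k] exceeded [B], some quotient at a point of (0, 1) would exceed [B] as well. *)
Lemma derive_right_le (a : R -> R) (k B : R) :
  is_derive_on [set s | 0 < s] a 0 k ->
  (forall s, 0 < s -> s < 1 -> a s <= a 0 + s * B) -> k <= B.
Proof.
move=> ak aB; rewrite leNgt; apply/negP => Bk.
have : \forall s \near within [set s : R | 0 < s] 0^',
    B < (s - 0)^-1 *: (a s - a 0).
  by apply: cvgr_gt; [exact: ak|].
move=> H.
have {}H : \forall s \near (0 : R), s != 0 -> 0 < s ->
  B < (s - 0)^-1 *: (a s - a 0) := H.
have H0 : \forall s \near (0 : R)^'+, B < (s - 0)^-1 *: (a s - a 0).
  suff : \forall s \near (0 : R), 0 < s -> B < (s - 0)^-1 *: (a s - a 0) by [].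
  near=> s => s0.
  have Hs : s != 0 -> 0 < s -> B < (s - 0)^-1 *: (a s - a 0) by near: s.
  by apply: Hs; rewrite // gt_eqF.
have [s [[Bs s0] s1]] : exists s : R,
    (B < (s - 0)^-1 *: (a s - a 0) /\ 0 < s) /\ s < 1.
  apply: (@filter_ex _ (0 : R)^'+).
  near=> s; split; [split|]; near: s => //; first exact: nbhs_right_gt.
  exact: nbhs_right_lt.
move: Bs; rewrite subr0 -[_ *: _]/(_ * _) ltr_pdivlMl//.
by have := aB s s0 s1; lra.
Unshelve. all: by end_near. Qed.

Lemma strongly_convex_grad_le mu f p q : differentiable f p ->
  strongly_convex mu f ->
  f p + inner (grad f p) (q - p) + mu / 2 * `|q - p| ^+ 2 <= f q.
Proof.
move=> df cf.
have [h ->] : exists h, q = p + h by exists (q - p); rewrite addrC subrK.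
rewrite [p + h - p]addrAC subrr add0r.
have fp0 : p + 0 *: h = p by rewrite scale0r addr0.
(* The convex function [f - mu/2 |.|^2] along the segment from [p] to [p + h]; its slope at 0 is at
   most the slope of the chord. *)
pose a s := f (p + s *: h) + - (mu / 2) * inner (p + s *: h) (p + s *: h).
have da : is_derive_on [set s | 0 < s] a 0 (inner (grad f p) h - mu * inner p h).
  have L := @is_derive_on_line [set s | 0 < s] p h 0.
  have df0 : differentiable f (p + 0 *: h) by rewrite fp0.
  apply: is_derive_on_eq (is_derive_onD (is_derive_on_comp df0 L)
    (is_derive_onM (is_derive_on_cst _ (- (mu / 2)) 0) (is_derive_on_inner L L))) => //.
  by rewrite fp0 gradP// mul0r add0r (inner_sym h p); field.
have H := derive_right_le da (B := f (p + h) - mu / 2 * inner (p + h) (p + h)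
  - (f p - mu / 2 * inner p p)).
rewrite -inner_norm.
rewrite !innerDl !innerDr (inner_sym h p) in H *.
suff aB s : 0 < s -> s < 1 -> a s <= a 0 + s *
   (f (p + h) - mu / 2 * (inner p p + inner p h + (inner p h + inner h h)) -
          (f p - mu / 2 * inner p p)).
  by have := H aB; lra.
move=> s0 s1.
have := cf (Itv01 (ltW s0) (ltW s1)) (p + h) p (in_setT _) (in_setT _).
rewrite convRE /= /unstable.onem.
have -> : conv (Itv01 (ltW s0) (ltW s1)) (p + h : convex_lmodType X) (p : convex_lmodType X) = p + s *: h.
  rewrite /conv /= /unstable.onem scalerDr scalerBl scale1r addrC addrA subrK.
  by [].
rewrite /a fp0 -!inner_norm !innerDl !innerDr (inner_sym h p) => C; lra.
Qed.

(** Adding the first-order inequalities at [p] and [p + s h] gives strong monotonicity of the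
    gradient; dividing by [s^2] and letting [s] tend to 0 yields the Hessian bound. *)
Lemma hess_ge mu phi p h :
  (forall p q, phi p + inner (grad phi p) (q - p) + mu / 2 * `|q - p| ^+ 2
     <= phi q) ->
  differentiable (grad phi) p ->
  mu * inner h h <= inner (hess phi p h) h.
Proof.
move=> FO dg.
have fp0 : p + 0 *: h = p by rewrite scale0r addr0.
(* The sign turns the wanted lower bound into the upper bound that [derive_right_le] provides. *)
pose a s := -1 * inner (grad phi (p + s *: h)) h.
have da : is_derive_on [set s | 0 < s] a 0 (- inner (hess phi p h) h).
  have L := @is_derive_on_line [set s | 0 < s] p h 0.
  have dg0 : differentiable (grad phi) (p + 0 *: h) by rewrite fp0.
  apply: is_derive_on_eq (is_derive_onM (is_derive_on_cst _ (-1 : R) 0)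
    (is_derive_on_inner (is_derive_on_comp dg0 L) (is_derive_on_cst _ h 0))) => //.
  by rewrite fp0 inner0r /hess; ring.
suff : - inner (hess phi p h) h <= - (mu * inner h h) by lra.
apply: derive_right_le da _ => s s0 _.
have := FO p (p + s *: h); have := FO (p + s *: h) p.
have -> : p - (p + s *: h) = (- s) *: h by rewrite opprD addrA subrr add0r scaleNr.
have -> : p + s *: h - p = s *: h by rewrite addrAC subrr add0r.
rewrite -!inner_norm !innerZr !innerZl /a fp0.
move: (inner (grad phi (p + _)) h) (inner (grad phi p) h) (inner h h) => A B N H1 H2.
rewrite -(ler_pM2l s0); nra.
Qed.

End Gradient.

(** * The energy of one block and its rate of change *)

Section Energy.
Context {R : realType} {X : hilbertType R}.
Context (phi : X -> R) (xs : X) (alpha beta gamma r : R).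

(* The Bregman divergence of [phi] between [xs] and [p]. *)
Definition bregman (p : X) : R :=
  inner (grad phi p) (p - xs) - (phi p - phi xs).

Definition momentum (t : R) (p v : X) : X :=
  (alpha - 1) *: (p - xs) + t *: v.

Lemma inner_momentum h t p v :
  inner h (momentum t p v) = (alpha - 1) * inner h (p - xs) + t * inner h v.
Proof. by rewrite /momentum [LHS]innerDr !innerZr. Qed.

Definition energy (t : R) (p v : X) : R :=
  2^-1 * inner (momentum t p v) (momentum t p v)
  + t * (t * gamma + r) * (phi p - phi xs)
  + (alpha - 1) * beta * t * bregman p.

(* [c] is the coupling with the other block: in the system it equals a multiple
   of [A^*] (resp. [- A]) applied to the momentum of the other variable, so the
   last terms of the two blocks cancel. *)
Definition energy_rate (t : R) (p v c : X) : R :=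
  - (t ^+ 2 * beta * inner (hess phi p v) v)
  - ((alpha - 3) * t * gamma + (alpha - 2) * r) * (phi p - phi xs)
  - (alpha - 1) * (t * gamma + r - beta) * bregman p
  - (t * gamma + r) * inner c (momentum t p v).

Lemma is_derive_on_energy (D : set R) (x v : R -> X) (a c : X) (t : R) :
  differentiable phi (x t) -> differentiable (grad phi) (x t) ->
  t != 0 ->
  is_derive_on D x t (v t) -> is_derive_on D v t a ->
  a + (alpha / t) *: v t + beta *: hess phi (x t) (v t)
    + (gamma + r / t) *: (grad phi (x t) + c) = 0 ->
  is_derive_on D (fun s => energy s (x s) (v s)) t
    (energy_rate t (x t) (v t) c).
Proof.
move=> dphi dgrad t0 dx dv ode.
have du : is_derive_on D (fun s => x s - xs) t (v t).
  apply: is_derive_on_eq (is_derive_onD dx (is_derive_on_cst _ (- xs) t)) => //.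
  by rewrite addr0.
have dw : is_derive_on D (fun s => momentum s (x s) (v s)) t
    (alpha *: v t + t *: a).
  apply: is_derive_on_eq (is_derive_onD
    (is_derive_onZ (is_derive_on_cst _ (alpha - 1) t) du)
    (is_derive_onZ (is_derive_on_id _ t) dv)) => //.
  by rewrite scale0r add0r scale1r addrA scalerBl scale1r subrK.
have dPhi : is_derive_on D (fun s => phi (x s) - phi xs) t
    (inner (grad phi (x t)) (v t)).
  apply: is_derive_on_eq (is_derive_onD (is_derive_on_comp dphi dx)
    (is_derive_on_cst _ (- phi xs) t)) => //.
  by rewrite addr0 gradP.
(* The two terms [<grad phi(x), v>] cancel, leaving only the Hessian term. *)
have dB : is_derive_on D (fun s => bregman (x s)) t
    (inner (hess phi (x t) (v t)) (x t - xs)).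
  apply: is_derive_on_eq (is_derive_onD
    (is_derive_on_inner (is_derive_on_comp dgrad dx) du)
    (is_derive_onM (is_derive_on_cst _ (-1 : R) t) dPhi)).
    by move=> s; rewrite mulN1r.
  by rewrite /hess; ring.
(* The equation multiplied by [t] eliminates the acceleration from the derivative of the
   momentum. *)
have w'E : alpha *: v t + t *: a = - (t * beta) *: hess phi (x t) (v t)
    - (t * gamma + r) *: (grad phi (x t) + c).
  have aE : a = - ((alpha / t) *: v t + beta *: hess phi (x t) (v t)
    + (gamma + r / t) *: (grad phi (x t) + c)).
    by apply/eqP; rewrite -addr_eq0 !addrA; apply/eqP.
  rewrite aE scalerN !scalerDr !scalerA mulrCA divff// mulr1.
  rewrite (_ : t * (gamma + r / t) = t * gamma + r); last by field.
  by rewrite !opprD !addrA subrr add0r scaleNr.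
have did := is_derive_on_id D t.
have dq : is_derive_on D (fun s => s * (s * gamma + r)) t (2 * t * gamma + r).
  apply: is_derive_on_eq (is_derive_onM did (is_derive_onD
    (is_derive_onM did (is_derive_on_cst _ gamma t)) (is_derive_on_cst _ r t))) => //.
  by ring.
apply: is_derive_on_eq (is_derive_onD (is_derive_onD
  (is_derive_onM (is_derive_on_cst _ (2^-1 : R) t) (is_derive_on_inner dw dw))
  (is_derive_onM dq dPhi))
  (is_derive_onM (is_derive_onM (is_derive_on_cst _ ((alpha - 1) * beta) t) did) dB)) => //.
(* The terms in [<hess phi(x) v, x - xs>] and [<grad phi(x), v>] cancel against the derivatives of
   the other two summands of the energy; [<grad phi(x), x - xs>] splits into the divergence plus the
   gap of [phi]. *)
have w'w : inner (alpha *: v t + t *: a) (momentum t (x t) (v t)) =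
    - (t * beta) * ((alpha - 1) * inner (hess phi (x t) (v t)) (x t - xs)
                    + t * inner (hess phi (x t) (v t)) (v t))
    - (t * gamma + r) * ((alpha - 1) * inner (grad phi (x t)) (x t - xs)
                    + t * inner (grad phi (x t)) (v t)
                    + inner c (momentum t (x t) (v t))).
  rewrite w'E innerBl !innerZl innerDl.
  by rewrite (inner_momentum (hess _ _ _)) (inner_momentum (grad _ _)).
rewrite (inner_sym (momentum _ _ _) (alpha *: _ + _)) w'w /energy_rate /bregman.
by field.
Qed.

(** The only positive contribution left is [(alpha - 3) |w|^2 / 2]. Its velocity half is absorbed by
    the Hessian term through the first threshold, its position half by the divergence term through
    the second. *)
Lemma energy_rate_le (mu t : R) (p v c : X) :
  0 < t -> 3 <= alpha -> 0 < beta -> 0 < mu -> beta <= r ->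
  0 <= phi p - phi xs ->
  mu / 2 * `|p - xs| ^+ 2 <= bregman p ->
  mu * inner v v <= inner (hess phi p v) v ->
  alpha - 3 <= mu * beta * t ->
  2 * (alpha - 1) * (alpha - 3) <= mu * (gamma * t ^+ 2 - (alpha - 3) * beta * t) ->
  (alpha - 3) * energy t p v + t * energy_rate t p v c
    <= - (t * (t * gamma + r) * inner c (momentum t p v)).
Proof.
move=> t0 a3 b0 mu0 br Phi0 B0 H0 ht1 ht2.
have W : inner (momentum t p v) (momentum t p v) <=
    2 * (alpha - 1) ^+ 2 * `|p - xs| ^+ 2 + 2 * t ^+ 2 * inner v v.
  rewrite /momentum -inner_norm; move: (p - xs) => u.
  have := sqr_ge0 `|(alpha - 1) *: u - t *: v|.
  rewrite -inner_norm !innerDl !innerDr !innerNl !innerNr.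
  by rewrite !innerZl !innerZr (inner_sym v u) => S; lra.
rewrite /energy /energy_rate.
move: (inner (momentum _ _ _) (momentum _ _ _)) (inner c _) W => W C hW.
move: (inner (hess _ _ _) _) H0 => H H0.
move: (phi p - phi xs) Phi0 => Phi Phi0.
move: (bregman p) B0 => B B0.
have V0 : 0 <= inner v v by rewrite inner_norm sqr_ge0.
move: (inner v v) V0 H0 hW => V V0 H0 hW.
have N0 := sqr_ge0 `|p - xs|.
move: (`|p - xs| ^+ 2) N0 B0 hW => N N0 B0 hW.
have hH : (alpha - 3) * t ^+ 2 * V <= t ^+ 3 * beta * H.
  have : t ^+ 3 * beta * (mu * V) <= t ^+ 3 * beta * H.
    by apply: ler_wpM2l => //; rewrite mulr_ge0 ?exprn_ge0// ltW.
  have : (alpha - 3) * (t ^+ 2 * V) <= mu * beta * t * (t ^+ 2 * V).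
    by apply: ler_wpM2r => //; rewrite mulr_ge0 ?exprn_ge0// ltW.
  lra.
(* Up to the factor [alpha - 1] and the nonnegative [(r - beta) t], [- K] is the net coefficient of
   the divergence. *)
set K := gamma * t ^+ 2 - (alpha - 3) * beta * t in ht2.
have K0 : 0 <= K.
  rewrite -(pmulr_rge0 _ mu0); apply: le_trans ht2.
  by rewrite !mulr_ge0//; lra.
have hB : (alpha - 1) * (alpha - 3) * N <= K * B.
  have : K * (mu / 2 * N) <= K * B by exact: ler_wpM2l.
  have : 2 * (alpha - 1) * (alpha - 3) * N <= mu * K * N by exact: ler_wpM2r.
  lra.
have hB' : (alpha - 1) * ((alpha - 1) * (alpha - 3) * N) <= (alpha - 1) * (K * B).
  by apply: ler_wpM2l => //; lra.
have B00 : 0 <= B by apply: le_trans B0; rewrite mulr_ge0// divr_ge0// ltW.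
have hr : 0 <= (alpha - 1) * ((r - beta) * t * B).
  by rewrite !mulr_ge0//; lra.
have hP : 0 <= t * r * Phi by rewrite !mulr_ge0//; lra.
have hW' : (alpha - 3) * W <= (alpha - 3) * (2 * (alpha - 1) ^+ 2 * N + 2 * t ^+ 2 * V).
  by apply: ler_wpM2l => //; lra.
rewrite /K in hB'; lra.
Qed.

End Energy.

(** * Affine perturbations, and existence of the adjoint *)

Section Affine.
Context {R : realType} {X : hilbertType R}.
Implicit Types (f phi : X -> R) (p q h c : X).

Lemma hess_affine (e k : R) c f p h : (forall z, differentiable f z) ->
  differentiable (grad f) p ->
  differentiable (grad (fun z => e * f z + inner c z + k)) p /\
  hess (fun z => e * f z + inner c z + k) p h = e *: hess f p h.
Proof.
move=> df dg.
(* The gradients must agree as functions before they are differentiated, hence differentiability of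
   [f] everywhere. *)
have GE : grad (fun z => e * f z + inner c z + k) = e *: grad f + cst c.
  by apply/funext => z; have [_ ->] := grad_affine e k c (df z).
have dF : is_diff p (e *: grad f + cst c) (e *: ('d (grad f) p : X -> X) + 0).
  by apply: is_diffD; apply: is_diffZ; exact: DiffDef.
split; first by rewrite GE; exact: ex_diff.
by rewrite /hess GE diff_val !fctE addr0.
Qed.

Lemma strongly_convex_affine_grad_le mu (k : R) c f p q : differentiable f p ->
  strongly_convex mu f ->
  let phi := fun z => 1 * f z + inner c z + k in
  phi p + inner (grad phi p) (q - p) + mu / 2 * `|q - p| ^+ 2 <= phi q.
Proof.
move=> df cf /=; have [_ ->] := grad_affine 1 k c df.
have := strongly_convex_grad_le q df cf.
rewrite scale1r innerDl [inner c (_ - _)]innerBr; lra.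
Qed.

(** Riesz representation of [h |-> <y, A h>] for each [y], followed by choice over [y]. *)
Lemma adjoint_ex {Y : hilbertType R} (A : {linear X -> Y}) :
  bounded_operator A ->
  exists B : Y -> X, forall y h, inner (A h) y = inner (B y) h.
Proof.
move=> [M AM].
have cA : continuous A.
  apply/linear_bounded_continuous/linear_boundedP.
  apply: filterS (nbhs_pinfty_ge (num_real M)) => N MN z.
  by apply: le_trans (AM z) _; apply: ler_wpM2r.
suff /choice[B HB] : forall y, exists b : X, forall h, inner (A h) y = inner b h.
  by exists B.
move=> y.
have [|b Hb] := @riesz R X (inner y \o A).
  move=> z; apply: continuous_comp; [exact: cA|exact: continuous_inner].
by exists b => h; rewrite -Hb /= inner_sym.
Qed.

End Affine.

(** * What the energy controls: gap, position and velocity *)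

Section EnergyBounds.
Context {R : realType} {X : hilbertType R}.

Lemma energy_bounds (phi : X -> R) (xs : X) (alpha beta gamma r mu t0 t : R)
    (p v : X) :
  3 <= alpha -> 0 < beta -> 0 < gamma -> beta <= r -> 0 < mu -> 0 < t0 ->
  t0 <= t -> 0 <= phi p - phi xs ->
  mu / 2 * `|p - xs| ^+ 2 <= bregman phi xs p ->
  let E := energy phi xs alpha beta gamma r t p v in
  let C := 2 / ((alpha - 1) * beta * mu) in
  [/\ 0 <= E, gamma * t ^+ 2 * (phi p - phi xs) <= E,
      t * `|p - xs| ^+ 2 <= C * E &
      t ^+ 2 * `|v| ^+ 2 <= (4 + 2 * (alpha - 1) ^+ 2 * C / t0) * E].
Proof.
move=> a3 b0 g0 br mu0 t00 t0t Phi0 B0 E C.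
have t_gt0 : 0 < t by apply: lt_le_trans t0t.
have r0 : 0 < r by apply: lt_le_trans br.
have a1 : 0 < alpha - 1 by lra.
(* Here [t v] is the momentum minus [(alpha - 1) (p - xs)]; the square expanded below is that of
   momentum plus [(alpha - 1) (p - xs)]. *)
have V : t ^+ 2 * `|v| ^+ 2 <=
    2 * `|momentum xs alpha t p v| ^+ 2 + 2 * (alpha - 1) ^+ 2 * `|p - xs| ^+ 2.
  rewrite /momentum; move: (p - xs) => u.
  have := sqr_ge0 `|2 *: ((alpha - 1) *: u) + t *: v|.
  rewrite -!inner_norm !innerDl !innerDr.
  by rewrite !innerZl !innerZr (inner_sym v u) => S; lra.
have EE : E = 2^-1 * `|momentum xs alpha t p v| ^+ 2
  + t * (t * gamma + r) * (phi p - phi xs)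
  + (alpha - 1) * beta * t * bregman phi xs p by rewrite -inner_norm.
have M0 := sqr_ge0 `|momentum xs alpha t p v|.
have N0 := sqr_ge0 `|p - xs|.
move: EE V M0 Phi0 B0 N0; clearbody E.
move: (`|momentum _ _ _ _ _| ^+ 2) (phi p - phi xs) (bregman _ _ _)
  (`|p - xs| ^+ 2) (`|v| ^+ 2) => M Phi B N V EE hV M0 Phi0 B0 N0.
have h1 : 0 <= gamma * t ^+ 2 * Phi by rewrite !mulr_ge0// ltW.
have h2 : 0 <= t * r * Phi by rewrite !mulr_ge0// ltW.
have k0 : 0 < (alpha - 1) * beta * t by rewrite !mulr_gt0.
have h3 : (alpha - 1) * beta * t * (mu / 2 * N) <= (alpha - 1) * beta * t * B.
  by apply: ler_wpM2l => //; exact: ltW.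
have h4 : 0 <= (alpha - 1) * beta * t * (mu / 2 * N).
  by rewrite mulr_ge0 ?(ltW k0)// mulr_ge0// divr_ge0// ltW.
have C0 : 0 < C by rewrite divr_gt0// !mulr_gt0.
have hN : t * N <= C * E.
  have : C * ((alpha - 1) * beta * t * (mu / 2 * N)) <= C * E.
    by apply: ler_wpM2l; [exact: ltW|lra].
  congr (_ <= _); rewrite /C; field.
  by rewrite !gt_eqF.
split => //; try lra.
(* Using [t0 <= t] keeps the velocity constant independent of [t]. *)
have hN' : N <= C / t0 * E.
  have : t0 * N <= C * E by apply: le_trans hN; apply: ler_wpM2r.
  by rewrite -ler_pdivlMl// => /le_trans; apply; rewrite mulrC mulrAC.
have : 2 * (alpha - 1) ^+ 2 * N <= 2 * (alpha - 1) ^+ 2 * (C / t0 * E).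
  by apply: ler_wpM2l => //; rewrite mulr_ge0// sqr_ge0.
lra.
Qed.

End EnergyBounds.

(** * Threshold time and conversion to power rates *)

Section Asymptotics.
Context {R : realType}.
Implicit Types a b g m t S K p : R.

(** With [c] the first summand and [Q] the radicand, both [t] and [t - c] are at least [sqrt Q], so
    [t (t - c) >= Q]. *)
Lemma threshold_ge a b g m t :
  3 <= a -> 0 < b -> 0 < g -> 0 < m ->
  (a - 3) * b / g + Num.sqrt (2 * (a - 1) * (a - 3) / (g * m)) <= t ->
  2 * (a - 1) * (a - 3) <= m * (g * t ^+ 2 - (a - 3) * b * t).
Proof.
move=> a3 b0 g0 m0.
set Q := 2 * _ * _ / _; set c := _ / g => ct.
have Q0 : 0 <= Q.
  by rewrite /Q divr_ge0 ?mulr_ge0//; try lra; exact: ltW.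
have c0 : 0 <= c by rewrite /c divr_ge0 ?mulr_ge0//; try lra; exact: ltW.
have s0 := sqrtr_ge0 Q; have sQ := sqr_sqrtr Q0.
have H : Q <= t * (t - c) by rewrite -sQ; nra.
have : g * m * Q <= g * m * (t * (t - c)).
  by apply: ler_wpM2l => //; rewrite mulr_ge0// ltW.
rewrite /Q /c mulrC divfK; last by rewrite gt_eqF// mulr_gt0.
move=> /le_trans; apply; rewrite le_eqVlt; apply/orP; left; apply/eqP.
by field; rewrite gt_eqF.
Qed.

Lemma sqrt_le_powR S K p t : 0 < t -> 0 <= S -> S * t `^ p <= K ->
  `|Num.sqrt S| <= Num.sqrt K * (1 / t `^ (p / 2)).
Proof.
move=> t0 S0 SK.
have tp : 0 < t `^ (p / 2) by rewrite powR_gt0.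
rewrite ger0_norm ?sqrtr_ge0// div1r ler_pdivlMr//.
rewrite -{1}[t `^ (p / 2)]ger0_norm ?(ltW tp)// -sqrtr_sqr -sqrtrM//.
apply: ler_wsqrtr; apply: le_trans SK; rewrite expr2 -powRD -?splitr//.
by apply/implyP => _; rewrite gt_eqF.
Qed.

Lemma powR_shift a b n t : 0 < t -> a = b + n%:R -> t `^ a = t ^+ n * t `^ b.
Proof.
move=> t0 ->; rewrite powRD ?powR_mulrn 1?mulrC ?(ltW t0)//.
by apply/implyP => _; rewrite gt_eqF.
Qed.

End Asymptotics.

(** * Decay of the weighted total energy and the three rates *)

Theorem theorem12 (R : realType) (X Y : hilbertType R)
    (f : X -> R) (g : Y -> R) (mu_f mu_g : R) (A : {linear X -> Y})
    (xs : X) (ys : Y) (t0 alpha beta_f beta_g gamma r : R)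
    (x : R -> X) (y : R -> Y) :
  let L := lagrangian f g A in
  let theta := 1 / (alpha - 1) in
  let I := [set t : R | t0 <= t] in
  let dx := derive_on I x in
  let dy := derive_on I y in
  let ddx := derive_on I dx in
  let ddy := derive_on I dy in
  let T :=
    Num.max (Num.max t0
      ((alpha - 3) / Num.min (mu_f * beta_f) (mu_g * beta_g)))
    (Num.max
      ((alpha - 3) * beta_f / gamma
       + Num.sqrt (2 * (alpha - 1) * (alpha - 3) / (gamma * mu_f)))
      ((alpha - 3) * beta_g / gamma
       + Num.sqrt (2 * (alpha - 1) * (alpha - 3) / (gamma * mu_g)))) in
  twice_continuously_differentiable f -> twice_continuously_differentiable g ->
  0 < mu_f -> 0 < mu_g ->
  strongly_convex mu_f f -> strongly_convex mu_g g ->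
  bounded_operator A ->
  saddle_point L xs ys ->
  0 < t0 -> 3 <= alpha -> 0 < beta_f -> 0 < beta_g -> 0 < gamma ->
  Num.max beta_f beta_g <= r ->
  twice_derivable_on I x -> twice_derivable_on I y ->
  (forall t, t0 <= t ->
    ddx t + (alpha / t) *: dx t
    + beta_f *: hess_xx L (x t) (y t) (dx t)
    + (gamma + r / t) *: grad_x L (x t) (y t + (theta * t) *: dy t) = 0) ->
  (forall t, t0 <= t ->
    ddy t + (alpha / t) *: dy t
    - beta_g *: hess_yy L (x t) (y t) (dy t)
    - (gamma + r / t) *: grad_y L (x t + (theta * t) *: dx t) (y t) = 0) ->
  [/\ bigO_from T
        (fun t => Num.sqrt (`|x t - xs| ^+ 2 + `|y t - ys| ^+ 2))
        (fun t => 1 / t `^ ((alpha - 2) / 2)),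
      bigO_from T
        (fun t => Num.sqrt (`|dx t| ^+ 2 + `|dy t| ^+ 2))
        (fun t => 1 / t `^ ((alpha - 1) / 2)) &
      bigO_from T
        (fun t => L (x t) ys - L xs (y t))
        (fun t => 1 / t `^ (alpha - 1))].


Proof.
move=> L theta I dx dy ddx ddy T Cf Cg muf0 mug0 scf scg bA sad t00 a3 bf0 bg0 g0.
rewrite ge_max => /andP[bfr bgr] Dx Dy odex odey.
have [df dgf _] := Cf; have [dg dgg _] := Cg.
have [B AB] := adjoint_ex bA.
have r0 : 0 < r by apply: lt_le_trans bfr.
have a1 : 0 < alpha - 1 by lra.
(* [L(., ys)] and [- L(xs, .)] in the affine form of the preceding lemmas; both are strongly convex
   and minimal at the saddle point. *)
pose phi z := 1 * f z + inner (B ys) z + - g ys.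
pose psi z := 1 * g z + inner (- A xs) z + - f xs.
have phiE z : phi z = L z ys by rewrite /phi /L /lagrangian AB mul1r.
have psiE z : psi z = - L xs z.
  by rewrite /psi /L /lagrangian innerNl mul1r; lra.
have Phi0 z : 0 <= phi z - phi xs by rewrite !phiE subr_ge0; case: (sad z ys).
have Psi0 z : 0 <= psi z - psi ys.
  by rewrite !psiE; case: (sad xs z) => ? _; lra.
have FOx p q := @strongly_convex_affine_grad_le _ _ mu_f (- g ys) (B ys) f p q (df p) scf.
have FOy p q := @strongly_convex_affine_grad_le _ _ mu_g (- f xs) (- A xs) g p q (dg p) scg.
have Bx p : mu_f / 2 * `|p - xs| ^+ 2 <= bregman phi xs p.
  have := FOx p xs; rewrite -/phi /bregman -[in inner _ (p - _)]opprB innerNr distrC; lra.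
have By p : mu_g / 2 * `|p - ys| ^+ 2 <= bregman psi ys p.
  have := FOy p ys; rewrite -/psi /bregman -[in inner _ (p - _)]opprB innerNr distrC; lra.
have dphi z : differentiable phi z by have [] := grad_affine 1 (- g ys) (B ys) (df z).
have dpsi z : differentiable psi z by have [] := grad_affine 1 (- f xs) (- A xs) (dg z).
have dgphi z : differentiable (grad phi) z.
  by have [] := hess_affine 1 (- g ys) (B ys) 0 df (dgf z).
have dgpsi z : differentiable (grad psi) z.
  by have [] := hess_affine 1 (- f xs) (- A xs) 0 dg (dgg z).
(* The gap between the gradient of the system, taken at the extrapolated point, and that of [phi];
   [cy] is its analogue for [psi]. *)
pose cx t := B (y t + (theta * t) *: dy t) - B ys.
pose cy t := A xs - A (x t + (theta * t) *: dx t).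
pose Ex t := energy phi xs alpha beta_f gamma r t (x t) (dx t).
pose Ey t := energy psi ys alpha beta_g gamma r t (y t) (dy t).
pose Ex' t := energy_rate phi xs alpha beta_f gamma r t (x t) (dx t) (cx t).
pose Ey' t := energy_rate psi ys alpha beta_g gamma r t (y t) (dy t) (cy t).
have Lx p : (L ^~ p) = fun z => 1 * f z + inner (B p) z + - g p.
  by apply/funext => z; rewrite /L /lagrangian AB mul1r.
have Ly p : L p = fun z => -1 * g z + inner (A p) z + f p.
  by apply/funext => z; rewrite /L /lagrangian; ring.
have dEx t : t0 <= t -> is_derive_on I Ex t (Ex' t).
  move=> tt; have t_gt0 : 0 < t by apply: lt_le_trans tt.
  apply: (is_derive_on_energy (dphi _) (dgphi _) _ (Dx.1 t tt) (Dx.2 t tt)).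
    by rewrite gt_eqF.
  rewrite -[RHS](odex t tt) /grad_x /hess_xx !Lx.
  have [_ ->] := hess_affine 1 (- g (y t)) (B (y t)) (dx t) df (dgf (x t)).
  have [_ ->] := hess_affine 1 (- g ys) (B ys) (dx t) df (dgf (x t)).
  have [_ ->] := grad_affine 1 (- g ys) (B ys) (df (x t)).
  have [_ ->] := grad_affine 1 (- g (y t + (theta * t) *: dy t))
     (B (y t + (theta * t) *: dy t)) (df (x t)).
  by rewrite /cx -[1 *: _ + B ys + _]addrA [B ys + _]addrC subrK.
have dEy t : t0 <= t -> is_derive_on I Ey t (Ey' t).
  move=> tt; have t_gt0 : 0 < t by apply: lt_le_trans tt.
  apply: (is_derive_on_energy (dpsi _) (dgpsi _) _ (Dy.1 t tt) (Dy.2 t tt)).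
    by rewrite gt_eqF.
  (* [L(x, .)] carries the factor -1 on [g], which makes the second equation take the form of the
     first. *)
  rewrite -[RHS](odey t tt) /grad_y /hess_yy !Ly.
  have [_ ->] := hess_affine (-1) (f (x t)) (A (x t)) (dy t) dg (dgg (y t)).
  have [_ ->] := hess_affine 1 (- f xs) (- A xs) (dy t) dg (dgg (y t)).
  have [_ ->] := grad_affine 1 (- f xs) (- A xs) (dg (y t)).
  have [_ ->] := grad_affine (-1) (f (x t + (theta * t) *: dx t))
     (A (x t + (theta * t) *: dx t)) (dg (y t)).
  rewrite /cy !scale1r !scaleN1r [_ - A xs + _]addrA subrK.
  by rewrite [beta_g *: - _]scalerN opprK -[in RHS]scalerN [in RHS]opprD opprK.
(* As [theta (alpha - 1) = 1], each momentum is [alpha - 1] times the extrapolated displacement;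
   adjointness makes the two pairings opposite. *)
have coupling t : inner (cx t) (momentum xs alpha t (x t) (dx t)) +
    inner (cy t) (momentum ys alpha t (y t) (dy t)) = 0.
  have e1 : momentum xs alpha t (x t) (dx t) =
      (alpha - 1) *: (x t + (theta * t) *: dx t - xs).
    rewrite /momentum [in RHS]addrAC [RHS]scalerDr scalerA; congr (_ + _ *: _).
    by rewrite /theta; field; rewrite gt_eqF.
  have e2 : momentum ys alpha t (y t) (dy t) =
      (alpha - 1) *: (y t + (theta * t) *: dy t - ys).
    rewrite /momentum [in RHS]addrAC [RHS]scalerDr scalerA; congr (_ + _ *: _).
    by rewrite /theta; field; rewrite gt_eqF.
  rewrite e1 e2 /cx /cy; move: (x t + _) (y t + _) => u v.
  rewrite !innerZr innerBl -!AB -innerBr -linearB -(opprB (u)) linearN.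
  rewrite [inner (- _) _]innerNl; ring.
have TD : `[T, +oo[ `<=` I.
  by move=> t; rewrite /= in_itv/= andbT /T !ge_max => /andP[/andP[]].
have T0 t : T <= t -> t0 <= t by rewrite /T !ge_max => /andP[/andP[]].
pose W t := t `^ (alpha - 3) * (Ex t + Ey t).
pose W' t := (alpha - 3) * t `^ (alpha - 4) * (Ex t + Ey t)
  + t `^ (alpha - 3) * (Ex' t + Ey' t).
have dW t : T <= t -> is_derive_on I W t (W' t).
  move=> /T0 tt; have t_gt0 : 0 < t by apply: lt_le_trans tt.
  apply: is_derive_onM; last by apply: is_derive_onD; [exact: dEx|exact: dEy].
  apply: is_derive_on_is_derive.
  have -> : alpha - 4 = alpha - 3 - 1 by lra.
  exact: is_derive1_powR.
have W'0 t : T <= t -> W' t <= 0.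
  move=> Tt; have tt := T0 _ Tt; have t_gt0 : 0 < t by apply: lt_le_trans tt.
  move: Tt; rewrite /T !ge_max => /andP[/andP[_ ht1] /andP[htf htg]].
  have m0 : 0 < Num.min (mu_f * beta_f) (mu_g * beta_g) by rewrite lt_min !mulr_gt0.
  move: ht1; rewrite ler_pdivrMr// mulrC => ht1.
  have hf1 : alpha - 3 <= mu_f * beta_f * t.
    by apply: le_trans ht1 _; rewrite ler_pM2r// ge_min lexx.
  have hg1 : alpha - 3 <= mu_g * beta_g * t.
    by apply: le_trans ht1 _; rewrite ler_pM2r// ge_min lexx orbT.
  have hf2 := threshold_ge a3 bf0 g0 muf0 htf.
  have hg2 := threshold_ge a3 bg0 g0 mug0 htg.
  have Hx := energy_rate_le (cx t) t_gt0 a3 bf0 muf0 bfr (Phi0 (x t)) (Bx (x t))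
    (hess_ge (dx t) FOx (dgphi (x t))) hf1 hf2.
  have Hy := energy_rate_le (cy t) t_gt0 a3 bg0 mug0 bgr (Psi0 (y t)) (By (y t))
    (hess_ge (dy t) FOy (dgpsi (y t))) hg1 hg2.
  (* Factoring out this power leaves exactly the combination bounded by [energy_rate_le] in each
     block. *)
  have -> : W' t = t `^ (alpha - 4) *
      (((alpha - 3) * Ex t + t * Ex' t) + ((alpha - 3) * Ey t + t * Ey' t)).
    rewrite /W' (@powR_shift _ (alpha - 3) (alpha - 4) 1)//; last by lra.
    by rewrite expr1; ring.
  rewrite mulr_ge0_le0 ?powR_ge0//; apply: le_trans (lerD Hx Hy) _.
  by rewrite -opprD -mulrDr coupling mulr0 oppr0.
have WT := is_derive_on_nonincreasing TD dW W'0.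
set K := W T in WT.
have boundx t : T <= t -> _ := fun Tt => energy_bounds (dx t) a3 bf0 g0 bfr muf0 t00
  (T0 t Tt) (Phi0 (x t)) (Bx (x t)).
have boundy t : T <= t -> _ := fun Tt => energy_bounds (dy t) a3 bg0 g0 bgr mug0 t00
  (T0 t Tt) (Psi0 (y t)) (By (y t)).
set Cx := 2 / ((alpha - 1) * beta_f * mu_f) in boundx.
set Cy := 2 / ((alpha - 1) * beta_g * mu_g) in boundy.
have Cx0 : 0 <= Cx by rewrite divr_ge0// ltW// !mulr_gt0.
have Cy0 : 0 <= Cy by rewrite divr_ge0// ltW// !mulr_gt0.
have weight_ge0 c : 0 <= c -> 0 <= 4 + 2 * (alpha - 1) ^+ 2 * c / t0.
  move=> c0; apply: addr_ge0 => //; apply: divr_ge0; last exact: ltW.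
  by apply: mulr_ge0 => //; apply: mulr_ge0 => //; exact: sqr_ge0.
(* Multiplying by [t^(alpha - 3)] turns energy bounds of weight [t^n] into bounds by [K]; [n = 1]
   serves positions, [n = 2] velocities and the gap. *)
have EK t c d U V n : T <= t -> 0 <= c -> 0 <= d ->
    t ^+ n * U <= c * Ex t -> t ^+ n * V <= d * Ey t ->
    (U + V) * t `^ (alpha - 3 + n%:R) <= (c + d) * K.
  move=> Tt c0 d0 hU hV.
  have t_gt0 : 0 < t by apply: lt_le_trans (T0 _ Tt).
  have [Ex0 _ _ _] := boundx t Tt; have [Ey0 _ _ _] := boundy t Tt.
  rewrite (powR_shift t_gt0 (erefl _)) mulrA.
  apply: (@le_trans _ _ (((c + d) * (Ex t + Ey t)) * t `^ (alpha - 3))).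
    apply: ler_wpM2r; first exact: powR_ge0.
    have : 0 <= c * Ey t by exact: mulr_ge0.
    have : 0 <= d * Ex t by exact: mulr_ge0.
    lra.
  rewrite -mulrA; apply: ler_wpM2l; first exact: addr_ge0.
  by rewrite mulrC; exact: WT.
split.
- exists (Num.sqrt ((Cx + Cy) * K)) => t Tt.
  have t_gt0 : 0 < t by apply: lt_le_trans (T0 _ Tt).
  apply: sqrt_le_powR => //.
  have [_ _ hx _] := boundx t Tt; have [_ _ hy _] := boundy t Tt.
  have -> : alpha - 2 = alpha - 3 + 1%:R by lra.
  exact: EK.
- exists (Num.sqrt ((4 + 2 * (alpha - 1) ^+ 2 * Cx / t0
    + (4 + 2 * (alpha - 1) ^+ 2 * Cy / t0)) * K)) => t Tt.
  have t_gt0 : 0 < t by apply: lt_le_trans (T0 _ Tt).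
  apply: sqrt_le_powR => //.
  have [_ _ _ hx] := boundx t Tt; have [_ _ _ hy] := boundy t Tt.
  rewrite (_ : _ `^ (alpha - 1) = t `^ (alpha - 3 + 2%:R)); last by congr (_ `^ _); lra.
  by apply: EK => //; apply: weight_ge0.
- exists ((gamma^-1 + gamma^-1) * K) => t Tt.
  have t_gt0 : 0 < t by apply: lt_le_trans (T0 _ Tt).
  have [_ hx _ _] := boundx t Tt; have [_ hy _ _] := boundy t Tt.
  (* [L xs ys] cancels between the two nonnegative gaps, each at most its energy over
     [gamma t^2]. *)
  have LE : L (x t) ys - L xs (y t) =
      (phi (x t) - phi xs) + (psi (y t) - psi ys) by rewrite !phiE !psiE; lra.
  have LE0 := addr_ge0 (Phi0 (x t)) (Psi0 (y t)).
  rewrite LE (ger0_norm LE0) div1r ler_pdivlMr ?powR_gt0//.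
  rewrite (_ : _ `^ (alpha - 1) = t `^ (alpha - 3 + 2%:R)); last by congr (_ `^ _); lra.
  apply: EK => //; rewrite ?invr_ge0 ?(ltW g0)//.
    by rewrite ler_pdivlMl// mulrA.
  by rewrite ler_pdivlMl// mulrA.
Qed.
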